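(* There exists an algorithm which, given a semi-complete digraph $T$ and an integer $k$, in time $O(|V(T)|^2)$ outputs either an ordering of $V(T)$ of width at most $m(k)$, or an $(m(k)+1)$-backward tangle in $T$, where $m(t)=100t^2+22t+1$. In the second case $\mathbf{ctw}(T)>k$.
   Context: All digraphs are simple. A digraph $T$ is semi-complete if for every two distinct vertices $v,w$ at least one of the arcs $(v,w)$, $(w,v)$ is present. $d^+(v)$ is the outdegree of $v$. For an ordering $\pi$ of $V=V(T)$, $\pi[\alpha]$ is the set of its first $\alpha$ vertices; $E(X,Y)$ is the set of arcs from $X$ to $Y$. The width of $\pi$ is $\max_{0\le\alpha\le|V|}|E(\pi[\alpha],V\setminus\pi[\alpha])|$ and the cutwidth $\mathbf{ctw}(T)$ is the minimum width of an ordering of $V$. For an integer $k$, a $k$-backward tangle in $T$ is a partition $(X,Y)$ of $V(T)$ such that (i) there are at least $k$ arcs directed from $X$ to $Y$, and (ii) $d^+(w)\ge d^+(v)$ for every $v\in X$ and $w\in Y$. *)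

(* Defs.v *)
From mathcomp Require Import all_boot all_order all_algebra.

Set Implicit Arguments.
Unset Strict Implicit.
Unset Printing Implicit Defensive.

Import Order.TTheory GRing.Theory Num.Theory.
Local Open Scope ring_scope.

(* A simple digraph on the vertex set V is an irreflexive relation e : rel V
   (opposite arcs (v, w), (w, v) may both be present). *)

Definition semi_complete (V : finType) (e : rel V) : Prop :=
  forall v w : V, v != w -> e v w || e w v.

Definition outdeg (V : finType) (e : rel V) (v : V) : nat := #|[set w | e v w]|.

Definition arcs (V : finType) (e : rel V) (X Y : {set V}) : {set V * V} :=
  [set a | [&& a.1 \in X, a.2 \in Y & e a.1 a.2]].

Definition is_ordering (V : finType) (s : seq V) : bool := perm_eq s (enum V).

Definition width (V : finType) (e : rel V) (s : seq V) : nat :=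
  \max_(a < #|V|.+1)
    #|arcs e [set v in take a s] ([set: V] :\: [set v in take a s])|.

(* Orderings are taken as tuples to have a finite range for the minimum;
   enum_tuple V is only the witness that the range is nonempty. *)
Definition ctw (V : finType) (e : rel V) : nat :=
  width e [arg min_(s < enum_tuple V | is_ordering s) width e s].

Definition backward_tangle (V : finType) (e : rel V) (k : int)
    (X Y : {set V}) : Prop :=
  [/\ X :|: Y = [set: V], X :&: Y = set0, k <= #|arcs e X Y|%:Z
    & forall v w, v \in X -> w \in Y -> (outdeg e v <= outdeg e w)%N].

Definition m (t : int) : int := 100 * t ^+ 2 + 22 * t + 1.

(* The model of computation is a random access machine under the unit-cost
   criterion, with addition and subtraction as its only arithmetic operations
   and with structured control flow. A program names finitely many registers;
   they hold integers, as do the cells of the memory, which is addressed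
   indirectly. *)
Inductive program : Type :=
| Skip
| Const (i : nat) (c : int)   (* R_i := c *)
| Add (i j l : nat)           (* R_i := R_j + R_l *)
| Sub (i j l : nat)           (* R_i := R_j - R_l *)
| ReadMem (i j : nat)         (* R_i := M[R_j] *)
| WriteMem (i j : nat)        (* M[R_i] := R_j *)
| Seq (p q : program)
| IfPos (i : nat) (p q : program)   (* tests 0 < R_i *)
| WhilePos (i : nat) (p : program).

Record state : Type := State { reg : nat -> int; mem : int -> int }.

Definition upd (A : eqType) (B : Type) (f : A -> B) (a : A) (b : B) : A -> B :=
  fun x => if x == a then b else f x.

Definition set_reg (s : state) (i : nat) (c : int) : state :=
  State (upd (reg s) i c) (mem s).

Definition set_mem (s : state) (a c : int) : state :=
  State (reg s) (upd (mem s) a c).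

(* exec p s t s' : started in s, the program p halts in s' after exactly t
   steps; every elementary instruction and every test is one step. *)
Inductive exec : program -> state -> nat -> state -> Prop :=
| exec_skip s : exec Skip s 1 s
| exec_const i c s : exec (Const i c) s 1 (set_reg s i c)
| exec_add i j l s : exec (Add i j l) s 1 (set_reg s i (reg s j + reg s l))
| exec_sub i j l s : exec (Sub i j l) s 1 (set_reg s i (reg s j - reg s l))
| exec_read i j s : exec (ReadMem i j) s 1 (set_reg s i (mem s (reg s j)))
| exec_write i j s : exec (WriteMem i j) s 1 (set_mem s (reg s i) (reg s j))
| exec_seq p q s s1 s2 t1 t2 :
    exec p s t1 s1 -> exec q s1 t2 s2 -> exec (Seq p q) s (t1 + t2)%N s2
| exec_if_true i p q s s1 t :
    0 < reg s i -> exec p s t s1 -> exec (IfPos i p q) s t.+1 s1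
| exec_if_false i p q s s1 t :
    reg s i <= 0 -> exec q s t s1 -> exec (IfPos i p q) s t.+1 s1
| exec_while_true i p s s1 s2 t1 t2 :
    0 < reg s i -> exec p s t1 s1 -> exec (WhilePos i p) s1 t2 s2 ->
    exec (WhilePos i p) s (t1 + t2)%N.+1 s2
| exec_while_false i p s :
    reg s i <= 0 -> exec (WhilePos i p) s 1 s.

(* Input: n in R_0, k in R_1, and the adjacency matrix of e, row by row, in
   the memory cells 0, ..., n * n - 1; everything else is 0. *)
Definition input (n : nat) (e : rel 'I_n) (k : int) : state :=
  State
    (fun i => if i == 0%N then n%:Z else if i == 1%N then k else 0)
    (fun a =>
       if [exists u : 'I_n, exists v : 'I_n, (a == (u * n + v)%N%:Z) && e u v]
       then 1 else 0).

(* Output: R_0 tells which kind of object is output (0 for an ordering, 1 for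
   a partition) and R_1 is the address of its first cell. An ordering is the
   list of its vertices, a partition (X, Y) is given by the indicator of X. *)
Definition outputs_ordering (n : nat) (s : state) (pi : seq 'I_n) : Prop :=
  reg s 0%N = 0 /\
  [seq mem s (reg s 1%N + i%:Z) | i <- iota 0 n] = [seq (val v)%:Z | v <- pi].

Definition outputs_partition (n : nat) (s : state) (X Y : {set 'I_n}) : Prop :=
  [/\ reg s 0%N = 1, X :|: Y = [set: 'I_n], X :&: Y = set0
    & forall v : 'I_n,
        mem s (reg s 1%N + (val v)%:Z) = if v \in X then 1 else 0].

(* Main.v *)
Require Import Defs.
From mathcomp Require Import all_boot all_order all_algebra.
From mathcomp Require Import zify ring.

(* The algorithm lists the vertices by nondecreasing outdegree. If one of the
   cuts along this list has more than [m k] arcs, the corresponding prefix and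
   its complement form an [m k + 1]-backward tangle. Selecting a vertex of
   minimum outdegree and updating the current cut by reading one row and one
   column of the adjacency matrix both take linear time per vertex.

   Conversely, in an ordering of width at most [k] of a semi-complete digraph the
   outdegree of a vertex differs from its position by at most [k]: at most [k]
   of its out-neighbours come after it, and at most [k] of the vertices before it
   are not out-neighbours. Hence the two sides of a backward tangle overlap, in
   this ordering, in a window of [2k + 1] positions only, and at most
   [2k + (2k + 1)^2 <= m k] arcs lead from [X] to [Y]; for negative [k] the bound
   on the cutwidth is trivial. *)

Set Implicit Arguments.
Unset Strict Implicit.
Unset Printing Implicit Defensive.

Import Order.TTheory GRing.Theory Num.Theory.
Local Open Scope ring_scope.

(** * Cuts and backward tangles *)

Section Cuts.
Variables (V : finType) (e : rel V).
Hypothesis e_irr : irreflexive e.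

Definition cut (s : seq V) : nat :=
  #|arcs e [set v in s] ([set: V] :\: [set v in s])|.

Lemma cut_le_width s a : (a <= #|V|)%N -> (cut (take a s) <= width e s)%N.
Proof.
rewrite -ltnS => a_lt.
exact: (leq_bigmax (F := fun a : 'I_#|V|.+1 => cut (take a s)) (Ordinal a_lt)).
Qed.

Lemma width_leP s c :
  (forall a, (a <= #|V|)%N -> (cut (take a s) <= c)%N) -> (width e s <= c)%N.
Proof. by move=> h; apply/bigmax_leqP => a _; apply: h; rewrite -ltnS. Qed.

Lemma card_arcsE X Y :
  #|arcs e X Y| = (\sum_x \sum_y [&& x \in X, y \in Y & e x y])%N.
Proof.
rewrite pair_big /= -sum1_card big_mkcond /=; apply: eq_bigr => -[x y] _ /=.
by rewrite inE /=; case: ifP.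
Qed.

Lemma card_arcs_le_mul (X Y : {set V}) : (#|arcs e X Y| <= #|X| * #|Y|)%N.
Proof.
rewrite -cardsX; apply/subset_leq_card/subsetP => -[x y].
by rewrite !inE /= => /and3P[-> ->].
Qed.

Lemma cut_le_sqr s : (cut s <= #|V| ^ 2)%N.
Proof.
by apply: leq_trans (card_arcs_le_mul _ _) _; rewrite leq_mul ?max_card.
Qed.

Lemma cut_nil : cut [::] = 0%N.
Proof.
apply/eqP; rewrite -leqn0; apply: leq_trans (card_arcs_le_mul _ _) _.
by rewrite (_ : [set v in [::]] = set0) ?cards0 //; apply/setP => v; rewrite !inE.
Qed.

(** Listing [b] removes from the cut the arcs from [s] to [b] and adds the arcs from [b] to the
    vertices still unlisted. The term at [v = b] vanishes by irreflexivity, so [b] may already count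
    as listed in the test, as it does in the algorithm. *)
Lemma cut_rcons s b : b \notin s ->
  (cut (rcons s b))%:Z =
  (cut s)%:Z + \sum_v (if v \in rcons s b then - (e v b : nat)%:Z else (e b v : nat)%:Z).
Proof.
move=> bs.
have cutE s' : (cut s')%:Z =
    \sum_x \sum_y ([&& x \in s', y \notin s' & e x y] : nat)%:Z.
  rewrite /cut card_arcsE -natz natr_sum; apply: eq_bigr => x _.
  by rewrite natr_sum; apply: eq_bigr => y _; rewrite !inE andbT natz.
(* The change of the cut, entry by entry: the first summand lives on column [b], the second on row
   [b]. *)
pose S := \sum_x \sum_y
  ((if y == b then (if x \in s then - (e x y : nat)%:Z else 0) else 0)
   + (if x == b then (if y \in rcons s b then 0 else (e x y : nat)%:Z) else 0)).
have -> : (cut (rcons s b))%:Z = (cut s)%:Z + S.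
  rewrite !cutE /S -big_split; apply: eq_bigr => x _.
  rewrite -big_split; apply: eq_bigr => y _ /=; rewrite !mem_rcons !inE.
  have [->|xb] := eqVneq x b; have [->|yb] := eqVneq y b;
    rewrite ?(negPf bs) ?e_irr //=.
  - by case: (y \in s).
  - by case: (x \in s) => //=; case: (e x b).
  - by rewrite !addr0.
congr (_ + _); rewrite /S.
under eq_bigr => x _ do rewrite big_split /=.
rewrite big_split /= [X in _ + X]exchange_big /= -big_split; apply: eq_bigr => v _ /=.
rewrite -!big_mkcond !big_pred1_eq mem_rcons inE.
have [->|_] := eqVneq v b; first by rewrite (negPf bs) /= e_irr addr0.
by case: (v \in s); rewrite /= ?add0r ?addr0.
Qed.

Lemma ctw_ordering : exists2 s, is_ordering s & ctw e = width e s.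
Proof.
rewrite /ctw; case: arg_minnP => [|s s_ord _]; first exact: perm_refl.
by exists s.
Qed.

(** * Outdegrees and positions in an ordering of small width *)

Section Positions.
Variables (s : seq V) (k : nat).
Hypotheses (e_sc : semi_complete e) (s_ord : is_ordering s)
           (s_width : (width e s <= k)%N).

Let s_uniq : uniq s. Proof. by rewrite (perm_uniq s_ord) enum_uniq. Qed.
Let s_mem v : v \in s. Proof. by rewrite (perm_mem s_ord) mem_enum. Qed.
Let s_size : size s = #|V|. Proof. by rewrite (perm_size s_ord) cardE. Qed.

Lemma mem_take_index a v : (v \in take a s) = (index v s < a)%N.
Proof. exact: in_take. Qed.

Lemma cut_prefix_le a : (cut (take a s) <= k)%N.
Proof.
have [a_le|/ltnW a_ge] := leqP a #|V|.
  by apply: leq_trans (cut_le_width _ _) s_width.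
have -> : take a s = take #|V| s by rewrite !take_oversize ?s_size.
by apply: leq_trans (cut_le_width _ _) s_width.
Qed.

Lemma card_index_range b c : (#|[set v | (b <= index v s < b + c)%N]| <= c)%N.
Proof.
set Z := [set v | _].
rewrite -[leqRHS](size_iota b) cardE -(size_map (index^~ s)).
apply: uniq_leq_size => [|i /mapP[v]].
  rewrite map_inj_in_uniq ?enum_uniq // => v w _ _ /(congr1 (nth v s)).
  by rewrite !nth_index.
by rewrite mem_enum inE mem_iota => ? ->.
Qed.

(** The arcs from [v] to later vertices cross the cut just behind [v], whose prefix has length
    [p.+1] because it contains [v]. *)
Lemma outdeg_le_index v : (outdeg e v <= index v s + k)%N.
Proof.
set p := index v s.
pose F := [set w | e v w & (p < index w s)%N].
have sub : [set w | e v w] \subset [set w | (index w s < p)%N] :|: F.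
  apply/subsetP => w; rewrite !inE => evw; rewrite evw /=.
  case: ltngtP => // /(congr1 (nth v s)); rewrite !nth_index // => wv.
  by rewrite wv e_irr in evw.
apply: leq_trans (subset_leq_card sub) _.
apply: leq_trans (leq_card_setU _ _) _.
apply: leq_add (card_index_range 0 _) _.
apply: leq_trans (cut_prefix_le p.+1).
rewrite -(card_imset _ (f := pair v)); last by move=> x y [].
apply/subset_leq_card/subsetP => a /imsetP[w].
rewrite inE => /andP[evw pw] ->; rewrite !inE /= !mem_take_index.
by rewrite evw ltnS leqnn -leqNgt pw.
Qed.

(** By semi-completeness an earlier vertex that is not an out-neighbour of [v] sends an arc to [v],
    and this arc crosses the cut just before [v]. *)
Lemma index_le_outdeg v : (index v s <= outdeg e v + k)%N.
Proof.
set p := index v s.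
pose F := [set u | e u v & (index u s < p)%N].
have sub : [set u | u \in take p s] \subset [set w | e v w] :|: F.
  apply/subsetP => u; rewrite !inE mem_take_index => up; rewrite up andbT.
  by apply: e_sc; apply: contraTneq up => <-; rewrite -leqNgt.
have -> : p = #|[set u | u \in take p s]|.
  by rewrite cardsE (card_uniqP (take_uniq _ s_uniq)) size_takel // index_size.
apply: leq_trans (subset_leq_card sub) _.
apply: leq_trans (leq_card_setU _ _) _; rewrite leq_add2l.
apply: leq_trans (cut_prefix_le p).
rewrite -(card_imset _ (f := fun u => (u, v))); last by move=> x y [].
apply/subset_leq_card/subsetP => a /imsetP[u].
rewrite inE => /andP[euv up] ->; rewrite !inE /= !mem_take_index.
by rewrite euv ltnn up.
Qed.

(* With [b] the first position of [Y], the degree condition confines [X] to the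
   positions below [b + 2k + 1]; an arc from [X] to [Y] crosses the cut at one
   of these two positions or has both ends between them. *)
Lemma card_arcs_degree_partition (X Y : {set V}) :
  (forall v w, v \in X -> w \in Y -> (outdeg e v <= outdeg e w)%N) ->
  (#|arcs e X Y| <= k.*2 + k.*2.+1 ^ 2)%N.
Proof.
move=> deg_le.
have [->|[w0 w0Y]] := set_0Vmem Y.
  by rewrite (leq_trans (card_arcs_le_mul _ _)) // cards0 muln0.
case: (arg_minnP (fun w => index w s) w0Y) => w wY w_min.
set b := index w s in w_min; pose c := (b + k.*2.+1)%N.
(* [index v s - k <= outdeg e v <= outdeg e w <= b + k]. *)
have X_lt v : v \in X -> (index v s < c)%N.
  move=> vX; have := deg_le _ _ vX wY.
  have := outdeg_le_index w; have := index_le_outdeg v; rewrite -/b /c; lia.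
pose Z := [set v | (b <= index v s < c)%N].
have Z_card : (#|Z| <= k.*2.+1)%N by exact: card_index_range.
pose cutset a := arcs e [set v in take a s] ([set: V] :\: [set v in take a s]).
have sub : arcs e X Y \subset cutset b :|: cutset c :|: arcs e Z Z.
  apply/subsetP => -[x y]; rewrite !inE /= !mem_take_index => /and3P[xX yY ->].
  rewrite !andbT (X_lt _ xX) -!leqNgt (w_min _ yY).
  by case: ltnP => //= _; case: leqP.
apply: leq_trans (subset_leq_card sub) _.
apply: leq_trans (leq_card_setU _ _) _.
rewrite leq_add //; first apply: leq_trans (leq_card_setU _ _) _.
  by rewrite -addnn leq_add ?cut_prefix_le.
by apply: leq_trans (card_arcs_le_mul _ _) _; rewrite leq_mul.
Qed.

End Positions.

Lemma ctw_gt_of_backward_tangle (k : int) X Y :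
  semi_complete e -> backward_tangle e (m k + 1) X Y -> k < (ctw e)%:Z.
Proof.
move=> e_sc [_ _ arcs_ge deg_le]; rewrite ltNge; apply/negP => ctw_le.
have [s s_ord ctwE] := ctw_ordering; rewrite ctwE in ctw_le.
case: k => [k|k] in arcs_ge ctw_le *; last by have := le_trans _ ctw_le; lia.
have := card_arcs_degree_partition e_sc s_ord (k := k) _ deg_le.
move: arcs_ge ctw_le; rewrite /m; nia.
Qed.

End Cuts.

(** * Executing programs *)

(** Total correctness with the running time as an argument of the postcondition, so that both are
    proved in one symbolic execution. *)
Definition runs (p : program) (s : state) (Q : nat -> state -> Prop) : Prop :=
  exists t s', exec p s t s' /\ Q t s'.

Lemma runs_skip s (Q : nat -> state -> Prop) : Q 1%N s -> runs Skip s Q.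
Proof. by exists 1%N, s; split=> //; constructor. Qed.

Lemma runs_const i c s (Q : nat -> state -> Prop) :
  Q 1%N (set_reg s i c) -> runs (Const i c) s Q.
Proof. by eexists _, _; split; first exact: exec_const. Qed.

Lemma runs_add i j l s (Q : nat -> state -> Prop) :
  Q 1%N (set_reg s i (reg s j + reg s l)) -> runs (Add i j l) s Q.
Proof. by eexists _, _; split; first exact: exec_add. Qed.

Lemma runs_sub i j l s (Q : nat -> state -> Prop) :
  Q 1%N (set_reg s i (reg s j - reg s l)) -> runs (Defs.Sub i j l) s Q.
Proof. by eexists _, _; split; first exact: exec_sub. Qed.

Lemma runs_read i j s (Q : nat -> state -> Prop) :
  Q 1%N (set_reg s i (Defs.mem s (reg s j))) -> runs (ReadMem i j) s Q.
Proof. by eexists _, _; split; first exact: exec_read. Qed.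

Lemma runs_write i j s (Q : nat -> state -> Prop) :
  Q 1%N (set_mem s (reg s i) (reg s j)) -> runs (WriteMem i j) s Q.
Proof. by eexists _, _; split; first exact: exec_write. Qed.

Lemma runs_seq p q s (Q : nat -> state -> Prop) :
  runs p s (fun t1 s1 => runs q s1 (fun t2 => Q (t1 + t2)%N)) ->
  runs (Seq p q) s Q.
Proof.
move=> [t1 [s1 [ex1 [t2 [s2 [ex2 Qs2]]]]]].
by exists (t1 + t2)%N, s2; split=> //; apply: exec_seq ex1 ex2.
Qed.

Lemma runs_if i p q s (Q : nat -> state -> Prop) :
  (0 < reg s i -> runs p s (fun t => Q t.+1)) ->
  (reg s i <= 0 -> runs q s (fun t => Q t.+1)) -> runs (IfPos i p q) s Q.
Proof.
move=> Hp Hq; case: (ltrP 0 (reg s i)) => [pos|npos].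
  have [t [s' [ex Qs]]] := Hp pos; exists t.+1, s'; split=> //.
  exact: exec_if_true.
have [t [s' [ex Qs]]] := Hq npos; exists t.+1, s'; split=> //.
exact: exec_if_false.
Qed.

(* The counter [i] holds the number [j] of iterations left; the body may
   decrease it further, which models an early exit. *)
Lemma runs_while i p c (I : nat -> state -> Prop) l s (Q : nat -> state -> Prop) :
  (forall j s, I j s -> reg s i = j%:Z) ->
  (forall j s, I j.+1 s ->
     runs p s (fun t s' => (t <= c)%N /\ exists2 j', (j' <= j)%N & I j' s')) ->
  I l s -> (forall t s', (t <= c.+1 * l + 1)%N -> I 0%N s' -> Q t s') ->
  runs (WhilePos i p) s Q.
Proof.
move=> Ireg body; elim/ltn_ind: l s Q => -[|j] IH s Q Is QI.
  exists 1%N, s; split; last by apply: QI; rewrite ?muln0.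
  by apply: exec_while_false; rewrite (Ireg _ _ Is).
have [t1 [s1 [ex1 [t1c [j' j'j Is1]]]]] := body _ _ Is.
have [t2 [s2 [ex2 [t2c Is2]]]] : runs (WhilePos i p) s1
    (fun t s' => (t <= c.+1 * j' + 1)%N /\ I 0%N s').
  by apply: (IH j' j'j) Is1 _.
exists (t1 + t2)%N.+1, s2; split; last by apply: QI => //; nia.
by apply: exec_while_true ex1 ex2; rewrite (Ireg _ _ Is).
Qed.

Definition block : seq program -> program := foldr Seq Skip.

Arguments upd A B f a b x /.

Ltac step :=
  lazymatch goal with
  | |- runs Skip _ _ => apply: runs_skip
  | |- runs (Seq _ _) _ _ => apply: runs_seq
  | |- runs (Const _ _) _ _ => apply: runs_const
  | |- runs (Add _ _ _) _ _ => apply: runs_add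
  | |- runs (Defs.Sub _ _ _) _ _ => apply: runs_sub
  | |- runs (ReadMem _ _) _ _ => apply: runs_read
  | |- runs (WriteMem _ _) _ _ => apply: runs_write
  | |- runs (IfPos _ _ _) _ _ => apply: runs_if
  end.
Ltac steps := rewrite /= ?/block /=; repeat (step; rewrite /=).

(** * The algorithm *)

(* After the initialisation, R_2 = n, R_3 = 1, R_4 = 0, R_5 is the threshold for
   the cuts, and R_6, R_7, R_8 are the addresses of three arrays of length n: the
   outdegrees, the indicator of the vertices listed so far, and the list. *)

(* R_5 is computed from [m (i + 1) - m i = 200 i + 122] and
   [m (- (i + 1)) - m (- i) = 200 i + 78]. *)
Definition threshold : program :=
  block [:: Const 5 1; Add 9 1 4; Const 10 122; Const 12 200;
    IfPos 9 Skip (block [:: Defs.Sub 9 4 9; Const 10 78]);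
    Defs.Sub 11 9 2; IfPos 11 (Add 9 2 4) Skip;
    WhilePos 9 (block [:: Add 5 5 10; Add 10 10 12; Defs.Sub 9 9 3])].

(** The machine does not multiply, so [n * n] comes from [n] additions. The arrays start right
    behind the adjacency matrix. *)
Definition addresses : program :=
  block [:: Const 6 0; Add 9 2 4;
    WhilePos 9 (block [:: Add 6 6 2; Defs.Sub 9 9 3]);
    Add 7 6 2; Add 8 7 2].

(** [R_10] ends at the start of the next row, so consecutive calls walk through the whole matrix. *)
Definition row_sum : program :=
  block [:: Const 12 0; Add 13 2 4;
    WhilePos 13 (block [:: ReadMem 14 10; Add 12 12 14; Add 10 10 3; Defs.Sub 13 13 3])].

Definition outdegrees : program :=
  block [:: Add 9 2 4; Const 10 0; Add 11 6 4;
    WhilePos 9 (block [:: row_sum;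
      WriteMem 11 12; Add 11 11 3; Defs.Sub 9 9 3])].

(* R_13 is the vertex found so far, R_12 its outdegree and R_14 the address of its
   row in the adjacency matrix. *)
Definition select : program :=
  block [:: Add 12 2 4; Const 13 0; Const 14 0; Add 15 2 4; Const 16 0; Const 17 0;
    WhilePos 15 (block [:: Add 18 7 16; ReadMem 18 18;
      IfPos 18 Skip (block [:: Add 19 6 16; ReadMem 19 19; Defs.Sub 18 12 19;
        IfPos 18 (block [:: Add 12 19 4; Add 13 16 4; Add 14 17 4]) Skip]);
      Add 16 16 3; Add 17 17 2; Defs.Sub 15 15 3])].

Definition append : program :=
  block [:: Add 18 7 13; WriteMem 18 3; WriteMem 10 13].

(** [R_16] runs through the marks, [R_17] through the row of the new vertex and [R_18], with stride
    [n], through its column. *)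
Definition update_cut : program :=
  block [:: Add 15 2 4; Add 16 7 4; Add 17 14 4; Add 18 13 4;
    WhilePos 15 (block [:: ReadMem 19 16;
      IfPos 19 (block [:: ReadMem 19 18; Defs.Sub 11 11 19])
               (block [:: ReadMem 19 17; Add 11 11 19]);
      Add 16 16 3; Add 17 17 3; Add 18 18 2; Defs.Sub 15 15 3])].

(* The loop counter R_9 is cleared as soon as the cut R_11 exceeds the threshold. *)
Definition order_by_outdegree : program :=
  block [:: Add 9 2 4; Add 10 8 4; Const 11 0; Const 0 0;
    WhilePos 9 (block [:: select; append; update_cut;
      Add 10 10 3; Defs.Sub 9 9 3; Defs.Sub 19 11 5;
      IfPos 19 (block [:: Const 0 1; Const 9 0]) Skip])].

(** No output has to be copied: after an early exit the marks are the indicator of [X], otherwise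
    the list is the ordering. *)
Definition algorithm : program :=
  block [:: Const 3 1; Const 4 0; Add 2 0 4;
    threshold; addresses; outdegrees; order_by_outdegree;
    IfPos 0 (Add 1 7 4) (Add 1 8 4)].

(** * Specifications of the subroutines *)

Definition params (n : nat) (st : state) : Prop :=
  [/\ reg st 2 = n%:Z, reg st 3 = 1 & reg st 4 = 0].

(* Truncating [|k|] at [n] keeps the computation linear in [n] and is harmless,
   as [m n] and [m (- n)] are at least [n ^ 2], which no cut exceeds. *)
Definition bound (k : int) (n : nat) : int :=
  m (if 0 < k then (minn `|k|%N n)%:Z else - (minn `|k|%N n)%:Z).

Definition layout (n : nat) (M : int) (st : state) : Prop :=
  [/\ params n st, reg st 5 = M, reg st 6 = (n * n)%N, reg st 7 = (n * n + n)%N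
    & reg st 8 = (n * n + n + n)%N].

Definition agree (rs : seq nat) (st st' : state) : Prop :=
  forall i, i \notin rs -> reg st' i = reg st i.

Lemma agree_set rs st st' i c :
  i \in rs -> agree rs st st' -> agree rs st (set_reg st' i c).
Proof.
move=> i_rs fr j j_rs; rewrite /= ifN ?fr //.
by apply: contraNneq j_rs => ->.
Qed.

Lemma agree_trans rs s1 s2 s3 : agree rs s1 s2 -> agree rs s2 s3 -> agree rs s1 s3.
Proof. by move=> fr12 fr23 i i_rs; rewrite fr23 ?fr12. Qed.

Lemma sub_agree rs rs' st st' :
  all [in rs'] rs -> agree rs st st' -> agree rs' st st'.
Proof. by move=> /allP sub fr i i_rs; apply: fr; apply: contra i_rs => /sub. Qed.

Lemma layout_agree n M rs st st' :
  agree rs st st' -> all [predC rs] (iota 2 7) -> layout n M st -> layout n M st'.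
Proof.
move=> fr /allP nrs [[r2 r3 r4] r5 r6 r7 r8].
by split; [split|..]; rewrite fr //; apply: nrs.
Qed.

Lemma runs_threshold n k st (Q : nat -> state -> Prop) :
  params n st -> reg st 1 = k ->
  (forall t st', (t <= 5 * n + 40)%N -> params n st' -> Defs.mem st' = Defs.mem st ->
     reg st' 5 = bound k n -> Q t st') ->
  runs threshold st Q.
Proof.
move=> [r2 r3 r4] r1 HQ.
(* After [i] rounds [R_5] is [m] at [i] or [- i] and [R_10] is the next difference; the second
   difference is 200 for both signs. *)
pose I j st' := exists2 i : nat, (i + j = minn `|k| n)%N &
  [/\ params n st', Defs.mem st' = Defs.mem st, reg st' 9 = j%:Z, reg st' 12 = 200 &
   if 0 < k then reg st' 5 = m i%:Z /\ reg st' 10 = 200 * i%:Z + 122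
   else reg st' 5 = m (- i%:Z) /\ reg st' 10 = 200 * i%:Z + 78].
pose L := WhilePos 9 (block [:: Add 5 5 10; Add 10 10 12; Defs.Sub 9 9 3]).
(* Proved once for the four branches that reach the loop: the sign of [k], and whether its absolute
   value exceeds [n]. *)
have loop st' (Q' : nat -> state -> Prop) : I (minn `|k| n) st' ->
    (forall t st'', (t <= 5 * n + 1)%N -> I 0%N st'' -> Q' t st'') -> runs L st' Q'.
  move=> I0 HQ'; apply: (runs_while (c := 4) (I := I)) I0 _.
  - by move=> j s [i _ []].
  - move=> j s [i ij [[s2 s3 s4] sm s9 s12 sk]]; steps; split=> //.
    exists j => //; exists i.+1; first by lia.
    split=> //=; first lia.
    by move: sk; case: ifP => _ [s5 s10]; rewrite s12 s5 s10 /m (intS i); split; ring.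
  - by move=> t st'' tj; apply: HQ'; nia.
rewrite /threshold /block /=; steps => k_pos; steps => c_n; steps;
  (apply: loop; last (move=> t st' tle [i i0 [pr me _ _ r5]]; steps; apply: HQ => //;
     [lia | by rewrite /bound -i0 addn0; case: ifP r5 => _ []]));
  (exists 0%N; [lia | split=> //=; first lia]);
  by case: ifP => k0; split; rewrite //; lia.
Qed.

Lemma runs_addresses n st (Q : nat -> state -> Prop) :
  params n st ->
  (forall t st', (t <= 4 * n + 20)%N -> layout n (reg st 5) st' ->
     Defs.mem st' = Defs.mem st -> Q t st') ->
  runs addresses st Q.
Proof.
move=> [r2 r3 r4] HQ; rewrite /addresses /block /=; steps.
pose I j st' := exists2 i : nat, (i + j = n)%N &
  [/\ params n st', Defs.mem st' = Defs.mem st, reg st' 5 = reg st 5,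
      reg st' 9 = j%:Z & reg st' 6 = (i * n)%N].
apply: (runs_while (c := 3) (I := I) (l := n)).
- by move=> j s [i _ []].
- move=> j s [i ij [[s2 s3 s4] sm s5 s9 s6]]; steps; split=> //.
  by exists j => //; exists i.+1; [lia|split=> //=; lia].
- by exists 0%N => //; split=> //=; lia.
- move=> t st' tle [i i0 [[s2 s3 s4] sm s5 s9 s6]]; steps.
  by apply: HQ => //; [lia|split=> //=; lia].
Qed.

Lemma runs_row_sum n st (Q : nat -> state -> Prop) p :
  params n st -> reg st 10 = p%:Z ->
  (forall t st', (t <= 6 * n + 20)%N -> agree [:: 10; 12; 13; 14] st st' ->
     Defs.mem st' = Defs.mem st -> reg st' 10 = (p + n)%N ->
     reg st' 12 = \sum_(0 <= v < n) Defs.mem st (p + v)%N -> Q t st') ->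
  runs row_sum st Q.
Proof.
move=> [r2 r3 r4] r10 HQ; rewrite /row_sum /block /=; steps.
pose I j st' := exists2 i : nat, (i + j = n)%N &
  [/\ agree [:: 10; 12; 13; 14] st st', Defs.mem st' = Defs.mem st,
      reg st' 13 = j%:Z, reg st' 10 = (p + i)%N &
      reg st' 12 = \sum_(0 <= v < i) Defs.mem st (p + v)%N].
apply: (runs_while (c := 5) (I := I) (l := n)).
- by move=> j s [i _ []].
- move=> j s [i ij [fr sm s13 s10 s12]]; steps; split=> //.
  have s3 := fr 3%N isT.
  exists j => //; exists i.+1; first lia.
  split=> //=; [by do !apply: agree_set | lia | lia |].
  by rewrite big_nat_recr //= s12 s10 sm.
- exists 0%N => //; split=> //=; [by do !apply: agree_set | lia | lia |].
  by rewrite big_geq.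
- move=> t st' tle [i]; rewrite addn0 => -> [fr sm s13 s10 s12]; steps.
  by apply: HQ => //; lia.
Qed.

Section Algorithm.
Variables (n : nat) (T : rel 'I_n) (M : int).

Definition stores_graph (mm : int -> int) : Prop :=
  forall u v : 'I_n, mm (u * n + v)%N = (T u v : nat).

Lemma address_lt (u v : 'I_n) : (u * n + v < n * n)%N.
Proof. by case: u v => [u ?] [v ?] /=; nia. Qed.

Lemma outdegE u : outdeg T u = (\sum_v T u v)%N.
Proof. by rewrite /outdeg cardsE -sum1_card big_mkcond. Qed.

Lemma runs_outdegrees st (Q : nat -> state -> Prop) :
  layout n M st -> stores_graph (Defs.mem st) ->
  (forall t st', (t <= 6 * n ^ 2 + 40 * n + 20)%N -> layout n M st' ->
     (forall a, a < (n * n)%N%:Z \/ (n * n + n)%N%:Z <= a ->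
        Defs.mem st' a = Defs.mem st a) ->
     (forall u : 'I_n, Defs.mem st' (n * n + u)%N = outdeg T u) -> Q t st') ->
  runs outdegrees st Q.
Proof.
move=> lay graph HQ; have [[r2 r3 r4] r5 r6 r7 r8] := lay.
rewrite /outdegrees /block /=; steps.
pose I j st' := exists2 i : nat, (i + j = n)%N &
  [/\ agree (iota 9 6) st st', reg st' 9 = j%:Z, reg st' 10 = (i * n)%N,
      reg st' 11 = (n * n + i)%N &
      (forall a, a < (n * n)%N%:Z \/ (n * n + n)%N%:Z <= a ->
         Defs.mem st' a = Defs.mem st a) /\
      (forall u : 'I_n, (u < i)%N -> Defs.mem st' (n * n + u)%N = outdeg T u)].
apply: (runs_while (c := (6 * n + 30)%N) (I := I) (l := n)).
- by move=> j s [i _ []].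
- move=> j s [i ij [fr s9 s10 s11 [out deg]]].
  have [[s2 s3 s4] _ s6 s7 s8] := layout_agree fr isT lay.
  have i_lt : (i < n)%N by lia.
  step; apply: (runs_row_sum (n := n)) s10 _ => // t s' tle fr' sm' s10' s12'.
  have s9' := fr' 9%N isT; have s3' := fr' 3%N isT; have s11' := fr' 11%N isT.
  steps; split; first lia.
  (* The row lies below address [n * n], where the earlier writes changed nothing. *)
  have row : reg s' 12 = outdeg T (Ordinal i_lt).
    rewrite s12' outdegE big_mkord -natz natr_sum; apply: eq_bigr => v _.
    have := address_lt (Ordinal i_lt) v => /= lt.
    by rewrite out ?natz -?(graph (Ordinal i_lt)) //; left.
  exists j => //; exists i.+1; first lia; split=> /=; try lia.
    do !apply: agree_set => //; apply: (@agree_trans _ st s _ fr).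
    exact: (@sub_agree [:: 10; 12; 13; 14] (iota 9 6) s s' isT fr').
  split=> [a a_out|u u_i].
    by rewrite s11' s11 sm' ifN ?out //; lia.
  rewrite s11' s11 sm' row; case: eqP => [ui|ui].
    by congr (outdeg T _)%:Z; apply: val_inj => /=; lia.
  by apply: deg; lia.
- exists 0%N => //; split=> //=; try lia.
  by do !apply: agree_set.
- move=> t st' tle [i]; rewrite addn0 => -> [fr _ _ _ [out deg]]; steps.
  apply: HQ => //; [nia|exact: layout_agree fr _ lay|].
  by move=> u; apply: deg.
Qed.

Definition stores_outdeg (mm : int -> int) : Prop :=
  forall u : 'I_n, mm (n * n + u)%N = outdeg T u.

Definition stores_marks (s : seq 'I_n) (mm : int -> int) : Prop :=
  forall u : 'I_n, mm (n * n + n + u)%N = (u \in s : nat).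

(** The initial value [n] of [R_12] exceeds every outdegree and stands for infinity; an unlisted
    vertex exists, so it is replaced during the scan. *)
Lemma runs_select s st (Q : nat -> state -> Prop) :
  layout n M st -> stores_outdeg (Defs.mem st) -> stores_marks s (Defs.mem st) ->
  (forall u, outdeg T u < n)%N -> (exists u, u \notin s) ->
  (forall t st' (b : 'I_n), (t <= 21 * n + 40)%N -> agree (iota 12 8) st st' ->
     Defs.mem st' = Defs.mem st -> reg st' 13 = b -> reg st' 14 = (b * n)%N ->
     b \notin s -> (forall u, u \notin s -> outdeg T b <= outdeg T u)%N -> Q t st') ->
  runs select st Q.
Proof.
move=> lay degs marks deg_lt [u0 u0s] HQ; have [[r2 r3 r4] r5 r6 r7 r8] := lay.
rewrite /select /block /=; steps.
pose I j st' := exists2 i : nat, (i + j = n)%N &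
  [/\ agree (iota 12 8) st st' /\ Defs.mem st' = Defs.mem st,
      reg st' 15 = j%:Z, reg st' 16 = i, reg st' 17 = (i * n)%N &
      (forall u : 'I_n, (u < i)%N -> u \notin s -> reg st' 12 <= outdeg T u) /\
      (reg st' 12 = n \/ exists b : 'I_n,
         [/\ b \notin s, reg st' 12 = outdeg T b, reg st' 13 = b &
             reg st' 14 = (b * n)%N])].
apply: (runs_while (c := 20) (I := I) (l := n)).
- by move=> j s' [i _ []].
- move=> j s' [i ij [[fr sm] s15 s16 s17 [low best]]].
  have [[s2 s3 s4] _ s6 s7 s8] := layout_agree fr isT lay.
  have i_lt : (i < n)%N by lia.
  pose u := Ordinal i_lt.
  steps; rewrite s16 s7 sm -!PoszD (marks u) => mark.
    have us : u \in s by case: (u \in s) mark.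
    steps; split=> //; exists j => //; exists i.+1; first lia.
    split=> /=; [|lia|lia|lia|].
      by split=> //; do !apply: agree_set.
    split=> [v vi vs|//]; apply: low => //.
    have : v != u by apply: contraNneq vs => ->.
    by rewrite -val_eqE /=; lia.
  have us : u \notin s by case: (u \in s) mark.
  steps; rewrite s6 s16 sm -!PoszD (degs u) => better; steps; split=> //;
    exists j => //; exists i.+1; try lia.
    split=> /=; [|lia|lia|lia|].
      by split=> //; do !apply: agree_set.
    split=> [v vi vs|]; last first.
      by right; exists u; split=> //=; lia.
    rewrite s4 addr0; move: vi; rewrite ltnS leq_eqVlt => /predU1P[vu|vi].
      by rewrite (_ : v = u) //; apply: val_inj.
    by have := low v vi vs; lia.
  split=> /=; [|lia|lia|lia|].
    by split=> //; do !apply: agree_set.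
  split=> [v vi vs|//].
  move: vi; rewrite ltnS leq_eqVlt => /predU1P[vu|vi]; last exact: low.
  by rewrite (_ : v = u); [lia | apply: val_inj].
- exists 0%N => //; split=> /=; [|lia|lia|lia|].
    by split=> //; do !apply: agree_set.
  by split=> //; left; lia.
- move=> t st' tle [i]; rewrite addn0 => -> [[fr sm] _ _ _ [low best]]; steps.
  case: best => [r12|[b [bs r12 r13 r14]]].
    by have := low u0 (ltn_ord u0) u0s; have := deg_lt u0; lia.
  apply: (HQ _ _ b) => //; first lia.
  by move=> u us; have := low u (ltn_ord u) us; lia.
Qed.

(** Used with a list that already ends in [b]; the sum is then the increment in [cut_rcons]. *)
Lemma runs_update_cut s st (Q : nat -> state -> Prop) (b : 'I_n) :
  layout n M st -> stores_graph (Defs.mem st) -> stores_marks s (Defs.mem st) ->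
  reg st 13 = b -> reg st 14 = (b * n)%N ->
  (forall t st', (t <= 15 * n + 40)%N -> agree (11%N :: iota 15 5) st st' ->
     Defs.mem st' = Defs.mem st ->
     reg st' 11 = reg st 11 +
       \sum_v (if v \in s then - (T v b : nat)%:Z else (T b v : nat)%:Z) -> Q t st') ->
  runs update_cut st Q.
Proof.
move=> lay graph marks r13 r14 HQ; have [[r2 r3 r4] r5 r6 r7 r8] := lay.
rewrite /update_cut /block /=; steps.
pose f (v : nat) := if 0 < Defs.mem st (n * n + n + v)%N
  then - Defs.mem st (v * n + b)%N else Defs.mem st (b * n + v)%N.
pose I j st' := exists2 i : nat, (i + j = n)%N &
  [/\ agree (11%N :: iota 15 5) st st' /\ Defs.mem st' = Defs.mem st,
      reg st' 15 = j%:Z, reg st' 16 = (n * n + n + i)%N /\ reg st' 17 = (b * n + i)%N,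
      reg st' 18 = (i * n + b)%N &
      reg st' 11 = reg st 11 + \sum_(0 <= v < i) f v].
apply: (runs_while (c := 14) (I := I) (l := n)).
- by move=> j s' [i _ []].
- move=> j s' [i ij [[fr sm] s15 [s16 s17] s18 s11]].
  have [[s2 s3 s4] _ s6 s7 s8] := layout_agree fr isT lay.
  steps; rewrite s16 sm => mark; steps; rewrite sm ?s17 ?s18; split=> //;
    exists j => //; (exists i.+1; first lia); split=> /=; try lia;
    try (by split=> //; do !apply: agree_set); try (by split; lia).
  + by rewrite big_nat_recr //= s11 /f mark addrA.
  + by rewrite big_nat_recr //= s11 /f ltNge mark addrA.
- exists 0%N => //; split=> /=; try lia.
    by split=> //; do !apply: agree_set.
  by rewrite big_geq // addr0.
- move=> t st' tle [i]; rewrite addn0 => -> [[fr sm] _ _ _ r11]; steps.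
  apply: HQ => //; first lia.
  rewrite r11 big_mkord; congr (_ + _); apply: eq_bigr => v _.
  by rewrite /f marks !graph; case: (v \in s).
Qed.

(** The list is stored twice: the marks give membership in constant time, the array of entries keeps
    the order. *)
Definition repr (s : seq 'I_n) (mm : int -> int) : Prop :=
  [/\ stores_graph mm, stores_outdeg mm, stores_marks s mm &
   [seq mm (n * n + n + n + i)%N | i <- iota 0 (size s)] = [seq (val v)%:Z | v <- s]].

Lemma repr_rcons s b mm : repr s mm ->
  repr (rcons s b) (upd (upd mm (n * n + n + b)%N 1) (n * n + n + n + size s)%N b).
Proof.
move=> [graph degs marks listing]; split.
- by move=> u v; have lt := address_lt u v; rewrite /= !ifN ?graph //; lia.
- by move=> u; have lt := ltn_ord u; rewrite /= !ifN ?degs //; lia.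
- move=> u; rewrite /= ifN; last by have := ltn_ord u; lia.
  rewrite mem_rcons inE -val_eqE /=; case: eqP => [[ub]|ub].
    by have -> : val u == val b by rewrite /=; lia.
  by have -> : (val u == val b) = false by rewrite /=; lia.
- rewrite size_rcons -addn1 iotaD map_cat /= eqxx cats1 map_rcons.
  congr rcons; rewrite -listing; apply/eq_in_map => i; rewrite mem_iota => i_lt.
  by rewrite !ifN //; have := ltn_ord b; lia.
Qed.

(** The degree condition of a backward tangle for [s] against its complement; as an invariant it
    takes the place of sortedness. *)
Definition closed_below (s : seq 'I_n) : Prop :=
  forall v w, v \in s -> w \notin s -> (outdeg T v <= outdeg T w)%N.

Lemma runs_order st (Q : nat -> state -> Prop) :
  irreflexive T -> (forall u, outdeg T u < n)%N -> 0 <= M ->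
  layout n M st -> repr [::] (Defs.mem st) ->
  (forall t st' (s : seq 'I_n), (t <= 36 * n ^ 2 + 150 * n + 50)%N ->
     layout n M st' -> uniq s ->
     closed_below s -> repr s (Defs.mem st') ->
     [/\ reg st' 0 = 0, size s = n & forall a, (cut T (take a s))%:Z <= M] \/
     reg st' 0 = 1 /\ M < (cut T s)%:Z -> Q t st') ->
  runs order_by_outdegree st Q.
Proof.
move=> T_irr deg_lt M_ge0 lay rep HQ; have [[r2 r3 r4] r5 r6 r7 r8] := lay.
rewrite /order_by_outdegree /block /=; steps.
(* The second alternative is the early exit: its counter is 0, so the body never starts from it. *)
pose I j st' := exists s : seq 'I_n,
  [/\ uniq s /\ closed_below s, repr s (Defs.mem st'),
      layout n M st' /\ reg st' 9 = j%:Z, 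
      reg st' 10 = (n * n + n + n + size s)%N /\ reg st' 11 = cut T s &
      [/\ reg st' 0 = 0, (size s + j)%N = n & forall a, (cut T (take a s))%:Z <= M] \/
      [/\ reg st' 0 = 1, j = 0%N & M < (cut T s)%:Z]].
apply: (runs_while (c := (36 * n + 120)%N) (I := I) (l := n)).
- by move=> j s' [s [_ _ []]].
- move=> j st1 [s [[uniq_s low_s] rep1 [lay1 s9] [s10 s11]]].
  case=> [[s0 size_s cuts]|[_ //]].
  have [graph degs marks listing] := rep1.
  have [u0 u0s] : exists u, u \notin s.
    apply/existsP; rewrite -negb_forall; apply/negP => /forallP all_s.
    have : (size (enum 'I_n) <= size s)%N by apply: uniq_leq_size; rewrite ?enum_uniq.
    by rewrite -cardE card_ord; lia.
  step; apply: (runs_select lay1 degs marks deg_lt); first by exists u0.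
  move=> t2 st2 b t2le fr2 mem2 b13 b14 bs b_min.
  have lay2 := layout_agree fr2 isT lay1.
  have [[q2 q3 q4] q5 q6 q7 q8] := lay2.
  have q9 := fr2 9%N isT; have q10 := fr2 10%N isT; have q11 := fr2 11%N isT.
  have q0 := fr2 0%N isT.
  rewrite /append /block /=; steps.
  set st3 := set_mem _ _ _.
  have rep3 : repr (rcons s b) (Defs.mem st3).
    have := repr_rcons b rep1; rewrite /st3 /= q10 s10 q7 b13 -PoszD q3 mem2.
    by [].
  have lay3 : layout n M st3 by [].
  have [graph3 _ marks3 _] := rep3.
  apply: (runs_update_cut lay3 graph3 marks3 b13 b14) => t4 st4 t4le fr4 mem4 c11.
  have lay4 := layout_agree fr4 isT lay3.
  have c9 := fr4 9%N isT; have c10 := fr4 10%N isT; have c0 := fr4 0%N isT.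
  rewrite /= in c9 c10 c0.
  have c11' : reg st4 11 = cut T (rcons s b).
    by rewrite c11 cut_rcons //= q11 s11.
  have [[d2 d3 d4] d5 d6 d7 d8] := lay4.
  have uniq_sb : uniq (rcons s b) by rewrite rcons_uniq bs.
  have low_sb : closed_below (rcons s b).
    move=> v w; rewrite !mem_rcons !inE negb_or => /predU1P[->|vs] /andP[_ ws].
      exact: b_min.
    exact: low_s.
  steps => over; steps; split; try lia.
    exists 0%N => //; exists (rcons s b).
    split=> //; [by rewrite /= mem4 | |].
      by rewrite /= size_rcons; split; lia.
    by right; split=> //=; lia.
  exists j => //; exists (rcons s b).
  split=> //; [by rewrite /= mem4 | by split=> /=; [exact: lay4 | lia] | |].
    by rewrite /= size_rcons; split; lia.
  left; split=> /=; [lia | by rewrite size_rcons; lia | move=> a].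
  (* A prefix of the longer list is a prefix of [s] or the whole list, whose cut has just passed the
     test. *)
  have [a_le|a_gt] := leqP a (size s).
    by rewrite -cats1 takel_cat.
  by rewrite take_oversize ?size_rcons //; lia.
- exists [::]; split=> //=; [by split=> //=; lia | by split; rewrite ?cut_nil; lia |].
  by left; split=> // a; rewrite cut_nil.
- move=> t st' tle [s [[uniq_s low_s] rep' [lay' _] _ ends]]; steps.
  apply: (HQ _ _ s) => //; first nia.
  by case: ends => [[]|[]]; [left; split=> //; lia | right].
Qed.

End Algorithm.

(** * The truncated threshold and the initial memory *)

Lemma bound_le k n : bound k n <= m k.
Proof.
rewrite /bound /m; have := geq_minl `|k| n; move: (minn _ _) => i i_le.
case: ifP => k_pos.
  have [a kE] : exists a : nat, k = a%:Z by exists `|k|%N; lia.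
  by rewrite kE in i_le *; nia.
have [a kE] : exists a : nat, k = - a%:Z by exists `|k|%N; lia.
have {}i_le : (i <= a)%N by lia.
have -> : k = - (i + (a - i))%N%:Z by lia.
case: (a - i)%N => [|d]; first by rewrite addn0.
(* This is [m (- (i + d + 1)) - m (- i)]; integrality makes the constant [78 = 100 - 22]
   positive. *)
rewrite -subr_ge0 [leRHS](_ : _ = d.+1%:Z * (200 * i%:Z + 100 * d%:Z + 78)).
  by rewrite mulr_ge0.
by rewrite PoszD (intS d); ring.
Qed.

(** For an integer [t] the factors [t] and [100 * t + 22] never have opposite signs; over the reals
    [m] does take negative values. *)
Lemma m_ge0 t : 0 <= m t.
Proof.
rewrite /m [leRHS](_ : _ = t * (100 * t + 22) + 1); last by ring.
apply: addr_ge0 => //; case: (lerP 0 t) => t0; first by rewrite mulr_ge0 //; lia.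
by rewrite mulr_le0 //; lia.
Qed.

(** A truncation that changes [k] gives at least [100 * n ^ 2 - 22 * n + 1 >= n ^ 2]. Hence a
    threshold exceeded by some cut is exact. *)
Lemma bound_eq k n : bound k n < (n ^ 2)%N%:Z -> bound k n = m k.
Proof.
rewrite /bound; case: (leqP `|k| n) => [le _|_].
  by congr m; case: ifP; lia.
have sqr_ge : (n <= n * n)%N by case: n => // n; rewrite leq_pmulr.
by rewrite /m -mulnn !expr2; case: ifP => _; nia.
Qed.

Lemma mem_input n (T : rel 'I_n) k (u v : 'I_n) :
  Defs.mem (input T k) (u * n + v)%N = (T u v : nat).
Proof.
rewrite /=; case: existsP => [[u' /existsP[v' /andP[/eqP[eq] Tuv']]]|no].
  have n_gt0 : (0 < n)%N by apply: leq_trans (ltn_ord u).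
  (* Division by [n] recovers the row from the address. *)
  have uu : u = u'.
    apply: val_inj; have := congr1 (divn^~ n) eq.
    by rewrite /= !divnMDl // !divn_small // !addn0.
  have vv : v = v' by apply: val_inj; move: eq; rewrite uu => /addnI.
  by rewrite uu vv Tuv'.
case Tuv: (T u v) => //; case: no; exists u; apply/existsP; exists v.
by rewrite eqxx.
Qed.

(** The zeros behind the matrix serve as the marks of the empty list. *)
Lemma mem_input_out n (T : rel 'I_n) k a :
  (n * n)%N%:Z <= a -> Defs.mem (input T k) a = 0.
Proof.
move=> a_ge; rewrite /=; case: existsP => // -[u /existsP[v /andP[/eqP aE _]]].
by have := address_lt u v; lia.
Qed.

Theorem theorem19 :
  exists (A : program) (C : nat),
    forall (n : nat) (T : rel 'I_n) (k : int),
      irreflexive T -> semi_complete T ->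
      exists (t : nat) (s : state),
        [/\ exec A (input T k) t s,
            (0 < n)%N -> (t <= C * n ^ 2)%N
          & (exists pi : seq 'I_n,
               [/\ outputs_ordering s pi, is_ordering pi
                 & (width T pi)%:Z <= m k])
            \/
            (exists X Y : {set 'I_n},
               [/\ outputs_partition s X Y, backward_tangle T (m k + 1) X Y
                 & k < (ctw T)%:Z])].
Proof.
(* For positive [n] the bound below is at most [(42 + 250 + 200) * n ^ 2]. *)
exists algorithm, 500%N => n T k T_irr T_sc.
suff [t [s [ex [tle out]]]] : runs algorithm (input T k) (fun t s =>
    (t <= 42 * n ^ 2 + 250 * n + 200)%N /\
    ((exists pi : seq 'I_n,
        [/\ outputs_ordering s pi, is_ordering pi & (width T pi)%:Z <= m k]) \/
     (exists X Y : {set 'I_n},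
        [/\ outputs_partition s X Y, backward_tangle T (m k + 1) X Y
          & k < (ctw T)%:Z]))).
  by exists t, s; split=> //; nia.
have deg_lt u : (outdeg T u < n)%N.
  rewrite -[n in (_ < n)%N]card_ord -cardsT; apply/proper_card/properP.
  by split; [exact: subsetT | exists u; rewrite !inE ?T_irr].
rewrite /algorithm /block /=; steps.
apply: (runs_threshold (n := n) (k := k)) => //.
  by split; rewrite /= ?addr0.
move=> t1 s1 t1le pr1 mem1 r5; step; apply: runs_addresses pr1 _.
move=> t2 s2 t2le lay2 mem2; rewrite r5 in lay2; rewrite {}mem1 in mem2.
step; apply: (runs_outdegrees (T := T) lay2).
  by move=> u v; rewrite mem2 mem_input.
move=> t3 s3 t3le lay3 out3 deg3.
step; apply: (runs_order T_irr deg_lt (m_ge0 _) lay3).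
  split=> //.
  - move=> u v; rewrite out3 ?mem2 ?mem_input //.
    by left; have := address_lt u v; lia.
  - move=> u; rewrite out3 ?mem2 ?mem_input_out //; lia.
move=> t4 s4 s t4le [[r2 r3 r4] _ _ r7 r8] uniq_s sorted_s [_ _ marks listing].
case=> [[r0 size_s cuts]|[r0 cut_gt]]; step; step; rewrite r0 // => _; steps;
  (split; first by lia).
  left; exists s; split.
  - split=> //=.
    rewrite -listing size_s; apply: eq_map => i /=.
    by rewrite r4 r8 addr0 -PoszD.
  - apply: uniq_perm; rewrite ?enum_uniq // => v; rewrite mem_enum inE.
    have /(_ (enum 'I_n)) [] := uniq_min_size uniq_s.
    + by move=> w _; rewrite mem_enum.
    + by rewrite -cardE card_ord size_s.
    + by move=> _ ->; rewrite mem_enum.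
  (* Truncation only lowers the threshold, so cuts within it are within [m k]. *)
  - have := bound_le k n; have := m_ge0 k; case: (m k) => // b _ le.
    by apply: width_leP => a _; rewrite -lez_nat; apply: le_trans (cuts a) le.
have mkE : bound k n = m k.
  apply: bound_eq; apply: lt_le_trans cut_gt _.
  by have := cut_le_sqr T s; rewrite card_ord lez_nat.
have tangle : backward_tangle T (m k + 1) [set v in s] ([set: 'I_n] :\: [set v in s]).
  split; first by rewrite setDE setTI setUCr.
  - by rewrite setDE setTI setICr.
  - by rewrite lezD1 -mkE.
  - by move=> v w; rewrite !inE andbT; apply: sorted_s.
right; exists [set v in s], ([set: 'I_n] :\: [set v in s]).
split=> //; last exact: ctw_gt_of_backward_tangle tangle.
case: tangle => XY XIY _ _; split=> // v.
by rewrite /= r4 r7 addr0 -PoszD marks inE; case: (v \in s).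
Qed.
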